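(* Let $K$ be a field, $S=K[x_1,\ldots,x_n]$, and let $\mathfrak m=(x_1,\ldots,x_n)$ be the graded maximal ideal of $S$. Let $I\subset S$ be a monomial ideal. If $I$ has linear quotients, then $\mathfrak m I$ has linear quotients.
   Context: For a monomial ideal $I$, $G(I)$ denotes its unique minimal set of monomial generators. $I$ has linear quotients if there is an ordering $u_1,\ldots,u_m$ of $G(I)$ such that for each $i=2,\ldots,m$ the colon ideal $(u_1,\ldots,u_{i-1}):u_i$ is generated by a subset of the variables $\{x_1,\ldots,x_n\}$. *)

(* Defs.v *)
From mathcomp Require Export all_boot all_order all_algebra.
From mathcomp Require Export mpoly.

Set Implicit Arguments.
Unset Strict Implicit.
Unset Printing Implicit Defensive.

Import GRing.Theory.
Local Open Scope ring_scope.

(* Subsets of a ring are Prop-valued predicates, compared by [same_set];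
   MathComp's [idealrPred] only covers boolean predicates. *)
Definition same_set (T : Type) (A B : T -> Prop) : Prop :=
  forall x : T, A x <-> B x.

Section Ideals.
Variable R : comNzRingType.

Definition is_ideal (I : R -> Prop) : Prop :=
  [/\ I 0,
      forall f g : R, I f -> I g -> I (f + g)
    & forall a f : R, I f -> I (a * f)].

Definition ideal_gen (A : R -> Prop) : R -> Prop :=
  fun f => forall J : R -> Prop,
    is_ideal J -> (forall g : R, A g -> J g) -> J f.

Definition ideal_mul (I J : R -> Prop) : R -> Prop :=
  ideal_gen (fun h => exists f g : R, [/\ I f, J g & h = f * g]).

(* The colon ideal I : u of an ideal by an element. *)
Definition colon (I : R -> Prop) (u : R) : R -> Prop :=
  fun f => I (f * u).

End Ideals.

Section MonomialIdeals.
Variables (K : fieldType) (n : nat).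

(* Monomials are represented by their exponent vectors. *)
Definition monom_gen (M : 'X_{1..n} -> Prop) : {mpoly K[n]} -> Prop :=
  ideal_gen (fun f => exists2 m : 'X_{1..n}, M m & f = 'X_[m]).

Definition vars_gen (A : {set 'I_n}) : {mpoly K[n]} -> Prop :=
  ideal_gen (fun f => exists2 i : 'I_n, i \in A & f = 'X_i).

Definition max_ideal : {mpoly K[n]} -> Prop := vars_gen [set: 'I_n].

Definition monomial_ideal (I : {mpoly K[n]} -> Prop) : Prop :=
  exists M : 'X_{1..n} -> Prop, same_set I (monom_gen M).

(* G is the set G(I): it generates I, and no proper subset of it does. *)
Definition min_monom_gens (I : {mpoly K[n]} -> Prop)
    (G : 'X_{1..n} -> Prop) : Prop :=
  same_set I (monom_gen G) /\
  (forall H : 'X_{1..n} -> Prop, (forall m, H m -> G m) ->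
     same_set I (monom_gen H) -> forall m, G m -> H m).

(* The ordering u_1, ..., u_m of G(I) is the duplicate-free sequence s, indexed
   from 0, so that [take i s] lists the generators preceding [nth 0 s i]. *)
Definition linear_quotients (I : {mpoly K[n]} -> Prop) : Prop :=
  exists s : seq 'X_{1..n},
    [/\ uniq s,
        min_monom_gens I (fun m => m \in s)
      & forall i : nat, (0 < i < size s)%N ->
          exists A : {set 'I_n},
            same_set
              (colon (monom_gen (fun m => m \in take i s))
                     'X_[nth 0%MM s i])
              (vars_gen A)].

End MonomialIdeals.

Arguments max_ideal K n : clear implicits.

(* Main.v *)
(* Over a monomial ideal, linear quotients amount to an exchange property of the
   exponent vectors: whenever v precedes u there is a variable x_c with
   v_c > u_c such that some generator preceding u divides x_c u.  Since the
   generators form an antichain, that generator has degree at most deg u; hence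
   the exchange property also holds for every v of degree smaller than deg u,
   wherever v stands in the ordering.

   A minimal generator w of m I is x_d u for some generator u of I; call the
   first such u the origin of w, and order the minimal generators of m I by
   degree, then by the position of their origins.  Let w' precede w = x_d u.  If
   w' has the same origin, then w' = x_e u with e != d divides x_e w.
   Otherwise w' = x_e v, and the exchange property for v and u gives c and g
   with g dividing x_c u.  The case c = d is impossible: g would divide w, so w
   would be a multiple of g by a variable, against the choice of the origin u.
   So w'_c > w_c, and x_d g divides x_c w; a minimal generator of m I dividing
   x_d g precedes w. *)
Require Import Defs.
From mathcomp Require Import zify.

Set Implicit Arguments.
Unset Strict Implicit.
Unset Printing Implicit Defensive.

Import GRing.Theory.
Local Open Scope ring_scope.

(** * Ideals generated by a set *)

Section IdealClosure.
Variable R : comNzRingType.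
Implicit Types (A B J : R -> Prop).

Lemma ideal_gen_ideal A : is_ideal (ideal_gen A).
Proof.
split=> [J [] //|f g Af Ag J iJ AJ|a f Af J iJ AJ].
  by case: (iJ) => _ D _; apply: D; [exact: Af|exact: Ag].
by case: (iJ) => _ _ M; apply: M; exact: Af.
Qed.

Lemma ideal_gen_mem A f : A f -> ideal_gen A f.
Proof. by move=> Af J _; apply. Qed.

Lemma ideal_gen_sub A J : is_ideal J -> (forall g, A g -> J g) ->
  forall f, ideal_gen A f -> J f.
Proof. by move=> iJ AJ f; apply. Qed.

Lemma ideal_sum J (T : eqType) (r : seq T) (F : T -> R) :
  is_ideal J -> {in r, forall x, J (F x)} -> J (\sum_(x <- r) F x).
Proof.
move=> [J0 JD _] JF; rewrite big_seq.
by apply: (big_ind J) => // x /JF.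
Qed.

End IdealClosure.

(** * Membership in monomial ideals and in their colon ideals *)

Section MonomialMembership.
Variables (K : fieldType) (n : nat).
Implicit Types (M : 'X_{1..n} -> Prop) (m u v : 'X_{1..n}) (f : {mpoly K[n]}).

(** Since [ideal_gen] quantifies over all ideals, the support criterion of [monom_genP] becomes
    necessary once it is known to define an ideal. *)
Lemma divisible_supp_ideal M :
  is_ideal (fun f => {in msupp f, forall m, exists2 g, M g & (g <= m)%MM}).
Proof.
split=> [m|f g If Ig m /msuppD_le|a f If m /msuppM_le].
- by rewrite msupp0.
- by rewrite mem_cat => /orP[/If|/Ig].
case/allpairsP=> -[m1 m2] /= [_ /If[g Mg le_g] ->].
by exists g => //; apply: lepm_trans le_g (lem_addl _ _).
Qed.

Lemma monom_genP M f :
  monom_gen M f <-> {in msupp f, forall m, exists2 g, M g & (g <= m)%MM}.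
Proof.
split.
  move: f; apply: (ideal_gen_sub (divisible_supp_ideal M)) => _ [m Mm ->] m'.
  by rewrite msuppX inE => /eqP->; exists m => //; apply: lepm_refl.
move=> If; rewrite [f]mpolyE.
apply: ideal_sum (ideal_gen_ideal _) _ => m /If[g Mg le_g].
have [_ _ IM] := ideal_gen_ideal (fun f => exists2 m, M m & f = 'X_[m]).
rewrite -(submK le_g) mpolyXD -mul_mpolyC mulrA; apply: IM.
by apply: ideal_gen_mem; exists g.
Qed.

Lemma monom_genX M m :
  monom_gen M ('X_[m] : {mpoly K[n]}) <-> exists2 g, M g & (g <= m)%MM.
Proof.
rewrite monom_genP; split=> [|Mm m'].
  by apply; rewrite msuppX inE.
by rewrite msuppX inE => /eqP->.
Qed.

Lemma vars_genP (A : {set 'I_n}) f :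
  vars_gen A f <-> {in msupp f, forall m, exists2 i, i \in A & (0 < m i)%N}.
Proof.
have -> : vars_gen A f <->
    monom_gen (fun m => exists2 i : 'I_n, i \in A & m = U_(i)%MM) f.
  split; apply: (ideal_gen_sub (ideal_gen_ideal _)) => g.
    case=> i Ai ->; apply: ideal_gen_mem.
    by exists U_(i)%MM => //; exists i.
  by case=> _ [i Ai ->] ->; apply: ideal_gen_mem; exists i.
rewrite monom_genP; split=> If m /If.
  by case=> _ [i Ai ->]; rewrite lep1mP -lt0n; exists i.
by case=> i Ai m_i; exists U_(i)%MM; [exists i|rewrite lep1mP -lt0n].
Qed.

Lemma colonP M u f :
  colon (monom_gen M) 'X_[u] f <->
  {in msupp f, forall m, exists2 g, M g & (g <= m + u)%MM}.
Proof.
rewrite /colon monom_genP; split=> If m.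
  move=> fm; apply: If.
  by rewrite (perm_mem (msuppMX f u)) addmC map_f.
rewrite (perm_mem (msuppMX f u)) => /mapP[m' fm' ->].
by rewrite addmC; apply: If.
Qed.

(** The variable x_c lies in the colon ideal of [s] by [u] and divides v/gcd(u,v). *)
Definition exchange (s : seq 'X_{1..n}) u v : Prop :=
  exists2 c, (u c < v c)%N & exists2 g, g \in s & (g <= u + U_(c))%MM.

(** The colon ideal is generated by the monomials v/gcd(u,v), so variables generate it exactly when
    each of these is divisible by a variable of the colon ideal. *)
Lemma colon_varsP (s : seq 'X_{1..n}) u :
  (exists A : {set 'I_n},
     same_set (colon (monom_gen (fun m => m \in s)) ('X_[u] : {mpoly K[n]}))
              (vars_gen A)) <->
  {in s, forall v, exchange s u v}.
Proof.
split=> [[A colA] v sv|exch].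
  (* Subtraction is truncated, so [v - u] is the exponent vector of v/gcd(u,v). *)
  have /colA/vars_genP/(_ (v - u)%MM) :
      colon (monom_gen (fun m => m \in s)) 'X_[u] ('X_[v - u] : {mpoly K[n]}).
    apply/colonP=> m; rewrite msuppX inE => /eqP->; exists v => //.
    by apply/mnm_lepP=> i; rewrite mnmDE mnmBE; lia.
  rewrite msuppX inE eqxx => /(_ isT)[c Ac]; rewrite mnmBE subn_gt0 => u_c.
  exists c => //.
  have /colA/colonP/(_ U_(c)%MM) : vars_gen A ('X_c : {mpoly K[n]}).
    by apply: ideal_gen_mem; exists c.
  by rewrite msuppX inE eqxx addmC; apply.
(* The witness collects all variables of the colon ideal. *)
exists [set c | has (fun g => (g <= u + U_(c))%MM) s] => f.
rewrite colonP vars_genP; split=> If m /If.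
  case=> v sv le_v; have [c u_c [g sg le_g]] := exch v sv.
  exists c; first by rewrite inE; apply/hasP; exists g.
  by have /mnm_lepP/(_ c) := le_v; rewrite mnmDE; lia.
case=> c; rewrite inE => /hasP[g sg le_g] m_c; exists g => //.
apply: lepm_trans le_g _; rewrite addmC; apply/mnm_lepP=> i.
rewrite !mnmDE leq_add2r mnm1E.
by case: eqP => [<-|].
Qed.

End MonomialMembership.

(** * Divisibility of monomials and minimal elements *)

Section Divisibility.
Variable n : nat.
Implicit Types (u v w g : 'X_{1..n}) (s : seq 'X_{1..n}).

Lemma lepm_mdeg u v : (u <= v)%MM -> (mdeg u <= mdeg v)%N.
Proof. by move=> /submK<-; rewrite mdegD leq_addl. Qed.

Lemma lepm_mdeg_eq u v : (u <= v)%MM -> (mdeg v <= mdeg u)%N -> u = v.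
Proof.
move=> /submK<-; rewrite mdegD => le_uv.
have /eqP : mdeg (v - u) = 0%N by lia.
by rewrite mdeg_eq0 => /eqP->; rewrite add0m.
Qed.

Lemma lepm_add2r w u v : (u <= v)%MM -> (u + w <= v + w)%MM.
Proof.
by move=> /mnm_lepP le_uv; apply/mnm_lepP=> i; rewrite !mnmDE leq_add2r.
Qed.

Lemma lepm_neq_var u v : (u <= v)%MM -> u != v ->
  exists d, (u + U_(d) <= v)%MM.
Proof.
move=> le_uv neq_uv.
have [d lt_d] : exists d, (u d < v d)%N.
  apply/existsP; apply: contraNT neq_uv; rewrite negb_exists => /forallP ge_uv.
  apply/eqP/mnmP=> i; apply/eqP.
  by rewrite eqn_leq (mnm_lepP le_uv) leqNgt ge_uv.
exists d; apply/mnm_lepP=> i; rewrite mnmDE mnm1E.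
by case: eqP => [<-|_]; [rewrite addn1|rewrite addn0 (mnm_lepP le_uv)].
Qed.

Definition antichain s : Prop := {in s &, forall u v, (u <= v)%MM -> u = v}.

Definition minimals s : seq 'X_{1..n} :=
  [seq w <- s | all (fun v => (v <= w)%MM ==> (v == w)) s].

Lemma minimals_sub s : {subset minimals s <= s}.
Proof. by move=> w; rewrite mem_filter => /andP[]. Qed.

Lemma minimals_min s w v :
  w \in minimals s -> v \in s -> (v <= w)%MM -> v = w.
Proof.
rewrite mem_filter => /andP[/allP min_w _] /min_w /implyP le_eq.
by move=> /le_eq/eqP.
Qed.

Lemma minimals_below s w :
  w \in s -> exists2 v, v \in minimals s & (v <= w)%MM.
Proof.
have [k] := ubnP (mdeg w); elim: k w => // k IHk w lt_w sw.
have [min_w|] := boolP (w \in minimals s).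
  by exists w => //; apply: lepm_refl.
rewrite mem_filter sw andbT => /allPn[v sv]; rewrite negb_imply.
case/andP=> le_vw neq_vw.
have lt_vw : (mdeg v < mdeg w)%N.
  by rewrite ltnNge; apply: contra neq_vw => /(lepm_mdeg_eq le_vw)->.
have [v' min_v' le_v'] := IHk v (leq_trans lt_vw lt_w) sv.
by exists v' => //; apply: lepm_trans le_v' le_vw.
Qed.

End Divisibility.

(** * Linear quotients as an exchange property *)

Section MinimalGenerators.
Variables (K : fieldType) (n : nat).
Implicit Types (I : {mpoly K[n]} -> Prop) (s : seq 'X_{1..n}).

(** If [u] properly divided [v], the generators other than [v] would still generate, against
    minimality. *)
Lemma min_monom_gens_antichain I s :
  min_monom_gens I (fun m => m \in s) -> antichain s.
Proof.
move=> [genI minI] u v su sv le_uv; apply/eqP/negPn/negP => neq_uv.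
suff /minI/(_ _ v sv) : forall m, m \in s /\ m != v -> m \in s.
  case=> [f|_]; last by rewrite eqxx.
  rewrite genI !monom_genP; split=> If m /If[g]; last by case=> sg _; exists g.
  have [-> _ le_v|neq_g sg le_g] := eqVneq g v; last by exists g.
  by exists u => //; apply: lepm_trans le_uv le_v.
by move=> m [].
Qed.

Lemma antichain_min_monom_gens I s :
  same_set I (monom_gen (fun m => m \in s)) -> antichain s ->
  min_monom_gens I (fun m => m \in s).
Proof.
move=> genI anti_s; split=> // H sH genH m sm.
have : monom_gen H ('X_[m] : {mpoly K[n]}).
  by apply/genH/genI/monom_genX; exists m => //; apply: lepm_refl.
case/monom_genX=> h Hh le_h.
by rewrite -(anti_s h m (sH h Hh) sm le_h).
Qed.

Lemma linear_quotientsP I : linear_quotients I <->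
  exists s, [/\ uniq s, same_set I (monom_gen (fun m => m \in s)), antichain s
    & {in s, forall u, {in take (index u s) s, forall v,
         exchange (take (index u s) s) u v}}].
Proof.
split=> -[s [Us]].
  move=> minI lin; exists s; split=> //; first by case: minI.
    exact: min_monom_gens_antichain minI.
  move=> u su.
  (* The first generator has no predecessors, so its exchange condition is vacuous. *)
  have [->|pos_u] := posnP (index u s); first by move=> v; rewrite take0.
  apply/(colon_varsP K).
  have := lin (index u s); rewrite pos_u index_mem su nth_index //.
  by apply.
move=> genI anti_s exch; exists s; split=> //.
  exact: antichain_min_monom_gens.
move=> i /andP[_ lt_i]; apply/colon_varsP.
by have := exch _ (mem_nth 0%MM lt_i); rewrite index_uniq.
Qed.

End MinimalGenerators.

(** * Monomial generators of the product with the maximal ideal *)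

Section MaximalIdealProduct.
Variables (n : nat) (s : seq 'X_{1..n}).
Implicit Types (u v w g : 'X_{1..n}).

Definition var_multiples : seq 'X_{1..n} :=
  [seq (u + U_(d))%MM | u <- s, d <- enum 'I_n].

Lemma var_multiplesP w :
  reflect (exists u d, u \in s /\ w = (u + U_(d))%MM) (w \in var_multiples).
Proof.
apply: (iffP allpairsP) => [[[u d] [su _ ->]]|[u [d [su ->]]]].
  by exists u, d.
by exists (u, d); split=> //=; rewrite mem_enum.
Qed.

Lemma max_ideal_mul_monom_gen (K : fieldType) (I : {mpoly K[n]} -> Prop) :
  same_set I (monom_gen (fun m => m \in s)) ->
  same_set (ideal_mul (max_ideal K n) I)
           (monom_gen (fun m => m \in minimals var_multiples)).
Proof.
move=> genI f; split; last first.
  apply: (ideal_gen_sub (ideal_gen_ideal _)).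
  move=> _ [_ /minimals_sub/var_multiplesP[u [d [su ->]]] ->].
  apply: ideal_gen_mem; exists 'X_d, 'X_[u]; split.
  - by apply: ideal_gen_mem; exists d; rewrite ?in_setT.
  - by apply/(genI _)/monom_genX; exists u => //; apply: lepm_refl.
  - by rewrite addmC mpolyXD.
apply: (ideal_gen_sub (ideal_gen_ideal _)) => _ [p [q [mp Iq ->]]].
apply/monom_genP=> _ /msuppM_le/allpairsP[[m1 m2] /= [pm1 qm2 ->]].
have [d _ m1_d] := (vars_genP _ _).1 mp _ pm1.
have [u su le_u] := (monom_genP _ _).1 ((genI q).1 Iq) _ qm2.
have : (u + U_(d))%MM \in var_multiples by apply/var_multiplesP; exists u, d.
case/minimals_below=> v min_v le_v; exists v => //.
apply: lepm_trans le_v _; apply/mnm_lepP=> i; rewrite !mnmDE mnm1E addnC.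
by apply: leq_add; [case: eqP => [<-|]|apply: (mnm_lepP le_u)].
Qed.

(** * Exchange in lower degree, and the ordering of the product's generators *)

Hypothesis anti_s : antichain s.
Hypothesis exch_s : {in s, forall u, {in take (index u s) s, forall v,
  exchange (take (index u s) s) u v}}.

(** A larger degree would force g = x_c u, a multiple of [u], which the antichain forbids. *)
Lemma exchange_mdeg u g c :
  u \in s -> g \in s -> u != g -> (g <= u + U_(c))%MM -> (mdeg g <= mdeg u)%N.
Proof.
move=> su sg neq_ug le_g; rewrite leqNgt; apply/negP => lt_ug.
have def_g : g = (u + U_(c))%MM.
  by apply: lepm_mdeg_eq le_g _; rewrite mdegD mdeg1 addn1.
by move/eqP: neq_ug; apply; apply: anti_s => //; rewrite def_g lem_addr.
Qed.

(** Induction on the position of [v]: if [v] comes after [u], exchanging [v] against [u] yields an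
    earlier [g] of degree at most that of [v], to which the induction applies. *)
Lemma exchange_lower_degree u v :
  u \in s -> v \in s -> (mdeg v < mdeg u)%N ->
  exchange (take (index u s) s) u v.
Proof.
move=> su; have [k] := ubnP (index v s).
elim: k v => // k IHk v le_k sv lt_vu.
have neq_vu : v != u by apply: contraTneq lt_vu => ->; rewrite ltnn.
have [lt_idx|ge_idx] := ltnP (index v s) (index u s).
  by apply: exch_s => //; rewrite in_take.
have lt_idx : (index u s < index v s)%N.
  rewrite ltn_neqAle ge_idx andbT; apply: contra neq_vu => /eqP eq_idx.
  by rewrite -(nth_index u sv) -eq_idx nth_index.
have before_u : u \in take (index v s) s by rewrite in_take.
have [c v_c [g tg le_g]] := exch_s sv before_u.
have sg := mem_take tg.
rewrite in_take // in tg.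
have neq_vg : v != g by apply: contraTneq tg => ->; rewrite ltnn.
have le_gv := exchange_mdeg sv sg neq_vg le_g.
have [] := IHk g _ sg (leq_ltn_trans le_gv lt_vu); first by lia.
move=> c' u_c' exch_c'; exists c' => //.
(* For c' = c, [g c <= v c + 1 <= u c] contradicts [u c' < g c']; otherwise [g c' <= v c']. *)
have /mnm_lepP/(_ c') := le_g; rewrite mnmDE mnm1E.
by case: eqP => [eq_c|_]; rewrite -?eq_c in u_c' *; lia.
Qed.

(** A position in [s]; it is the default [size s] only when [w] is no variable multiple of an
    element of [s]. *)
Definition origin w : nat := find (fun u => [exists d, w == (u + U_(d))%MM]) s.

(* The lexicographic key (mdeg w, origin w), packed into a single number. *)
Definition sort_key w : nat := (mdeg w * (size s).+1 + origin w)%N.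

(** One monomial may arise as both x_d u and x_e v, hence [undup]. Elements with equal keys share
    their origin, and their relative order is immaterial. *)
Definition sorted_minimals : seq 'X_{1..n} :=
  sort (relpre sort_key leq) (undup (minimals var_multiples)).

Lemma origin_le w u d :
  u \in s -> w = (u + U_(d))%MM -> (origin w <= index u s)%N.
Proof.
move=> su def_w; rewrite -ltnS; apply: find_ltn; apply/hasP; exists u.
  by rewrite in_take // ltnSn.
by apply/existsP; exists d; rewrite def_w.
Qed.

Lemma originP w : uniq s -> w \in var_multiples ->
  exists u d, [/\ u \in s, w = (u + U_(d))%MM & index u s = origin w].
Proof.
move=> Us /var_multiplesP[u [d [su def_w]]].
have has_w : has (fun u => [exists d, w == (u + U_(d))%MM]) s.
  by apply/hasP; exists u => //; apply/existsP; exists d; rewrite def_w.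
have /existsP[e /eqP def_w'] := nth_find 0%MM has_w.
rewrite has_find in has_w.
by exists (nth 0%MM s (origin w)), e; rewrite mem_nth // index_uniq.
Qed.

Lemma origin_size w : (origin w <= size s)%N.
Proof. exact: find_size. Qed.

(** Origins stay below the multiplier [(size s).+1], so a degree gap outweighs any difference of
    origins. *)
Lemma sort_key_lt v w :
  (mdeg v < mdeg w)%N || (mdeg v <= mdeg w)%N && (origin v < origin w)%N ->
  (sort_key v < sort_key w)%N.
Proof.
have [ov ow] := (origin_size v, origin_size w).
by rewrite /sort_key; case/orP=> [|/andP[]]; nia.
Qed.

Lemma sort_key_le v w : (sort_key v <= sort_key w)%N ->
  (mdeg v < mdeg w)%N || (mdeg v == mdeg w) && (origin v <= origin w)%N.
Proof.
have [ov ow] := (origin_size v, origin_size w).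
rewrite /sort_key; have [//|lt_wv|->] := ltngtP (mdeg v) (mdeg w); last lia.
by nia.
Qed.

Lemma mem_sorted_minimals w :
  (w \in sorted_minimals) = (w \in minimals var_multiples).
Proof. by rewrite mem_sort mem_undup. Qed.

Lemma sort_key_trans : transitive (relpre sort_key leq).
Proof. by move=> x y z; apply: leq_trans. Qed.

Lemma sorted_minimals_sorted : sorted (relpre sort_key leq) sorted_minimals.
Proof. by apply: sort_sorted => x y; apply: leq_total. Qed.

Lemma sorted_minimals_le v w : w \in sorted_minimals ->
  v \in take (index w sorted_minimals) sorted_minimals ->
  (sort_key v <= sort_key w)%N /\ v != w.
Proof.
move=> tw tv; have sv := mem_take tv; rewrite in_take // in tv.
split; last by apply: contraTneq tv => ->; rewrite ltnn.
exact: (sorted_ltn_index sort_key_trans sorted_minimals_sorted) tv.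
Qed.

Lemma sorted_minimals_lt v w :
  v \in sorted_minimals -> w \in sorted_minimals ->
  (sort_key v < sort_key w)%N ->
  v \in take (index w sorted_minimals) sorted_minimals.
Proof.
move=> tv tw lt_vw; rewrite in_take // ltnNge.
apply: contraTN lt_vw; rewrite -leqNgt.
have refl : reflexive (relpre sort_key leq) by move=> x; apply: leqnn.
exact: (sorted_leq_index sort_key_trans refl sorted_minimals_sorted).
Qed.

Lemma antichain_sorted_minimals : antichain sorted_minimals.
Proof.
move=> u v; rewrite !mem_sorted_minimals => /minimals_sub Lu min_v.
exact: minimals_min min_v Lu.
Qed.

Lemma exchange_sorted_minimals : uniq s ->
  {in sorted_minimals, forall w,
    {in take (index w sorted_minimals) sorted_minimals, forall w',
      exchange (take (index w sorted_minimals) sorted_minimals) w w'}}.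
Proof.
move=> Us w tw w' before_w'.
have tw' := mem_take before_w'.
have [le_key neq_w'] := sorted_minimals_le tw before_w'.
have min_w := tw; rewrite mem_sorted_minimals in min_w.
have Lw' := tw'; rewrite mem_sorted_minimals in Lw'.
have [u [d [su def_w idx_u]]] := originP Us (minimals_sub min_w).
have [v [e [sv def_w' idx_v]]] := originP Us (minimals_sub Lw').
have [eq_vu|neq_vu] := eqVneq v u.
  have neq_ed : e != d.
    by apply: contra neq_w' => /eqP eq_ed; rewrite def_w' def_w eq_vu eq_ed.
  exists e; first by rewrite def_w' def_w eq_vu !mnmDE !mnm1E eqxx eq_sym
    (negbTE neq_ed) addn0 addn1.
  by exists w' => //; rewrite def_w' def_w eq_vu lepm_add2r ?lem_addr.
have [c u_c [g before_g le_g]] : exchange (take (index u s) s) u v.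
  (* Either [v] has smaller degree than [u], or the degrees agree and [v] precedes [u] in [s]. *)
  have /orP[] := sort_key_le le_key.
    rewrite def_w' def_w !mdegD !mdeg1 ltn_add2r.
    exact: exchange_lower_degree.
  case/andP=> _; rewrite -idx_u -idx_v => le_idx.
  apply: exch_s => //; rewrite in_take // ltn_neqAle le_idx andbT.
  apply: contra neq_vu => /eqP eq_idx.
  by rewrite -(nth_index u sv) eq_idx nth_index.
have sg := mem_take before_g; rewrite in_take // in before_g.
have neq_ug : u != g by apply: contraTneq before_g => ->; rewrite ltnn.
have le_gu := exchange_mdeg su sg neq_ug le_g.
have neq_cd : c != d.
  apply/negP => /eqP eq_cd; rewrite eq_cd -def_w in le_g.
  have neq_gw : g != w.
    apply/eqP => eq_gw; move: le_gu.
    by rewrite eq_gw def_w mdegD mdeg1 addn1 ltnn.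
  (* As [g] properly divides [w], some x_f g divides [w], and minimality makes them equal. *)
  have [f le_f] := lepm_neq_var le_g neq_gw.
  have Lf : (g + U_(f))%MM \in var_multiples.
    by apply/var_multiplesP; exists g, f.
  have := origin_le sg (esym (minimals_min min_w Lf le_f)).
  by rewrite -idx_u leqNgt before_g.
exists c.
  rewrite def_w def_w' !mnmDE !mnm1E eq_sym (negbTE neq_cd) addn0.
  exact: leq_trans u_c (leq_addr _ _).
have : (g + U_(d))%MM \in var_multiples by apply/var_multiplesP; exists g, d.
case/minimals_below=> w'' min_w'' le_w''; exists w''; last first.
  apply: lepm_trans le_w'' _.
  by rewrite def_w -addmA [(U_(d) + _)%MM]addmC addmA lepm_add2r.
apply: sorted_minimals_lt => //; first by rewrite mem_sorted_minimals.
apply: sort_key_lt.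
have deg_w : mdeg w = (mdeg u).+1 by rewrite def_w mdegD mdeg1 addn1.
have deg_g : mdeg (g + U_(d)) = (mdeg g).+1 by rewrite mdegD mdeg1 addn1.
(* If w'' = x_d g, its origin is at most the position of [g], before [u]; a proper divisor of x_d g
   has degree below that of [w]. *)
have [eq_w''|neq_w''] := eqVneq w'' (g + U_(d))%MM.
  rewrite eq_w'' deg_w deg_g !ltnS le_gu -idx_u /=; apply/orP; right.
  by apply: leq_ltn_trans before_g; apply: origin_le sg (erefl _).
apply/orP; left; rewrite deg_w; apply: leq_trans (_ : (mdeg g).+1 <= _)%N => //.
rewrite -deg_g ltnNge; apply: contra neq_w''.
by move=> /(lepm_mdeg_eq le_w'')->.
Qed.

End MaximalIdealProduct.

Theorem lemma2p5 (K : fieldType) (n : nat) (I : {mpoly K[n]} -> Prop) :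
  monomial_ideal I ->
  linear_quotients I ->
  linear_quotients (ideal_mul (max_ideal K n) I).
Proof.
move=> _ /linear_quotientsP[s [Us genI anti_s exch_s]].
apply/linear_quotientsP; exists (sorted_minimals s); split.
- by rewrite sort_uniq undup_uniq.
- move=> f; rewrite (max_ideal_mul_monom_gen genI f) !monom_genP.
  by split=> If m /If[g tg]; exists g; rewrite ?mem_sorted_minimals // in tg *.
- exact: antichain_sorted_minimals.
- exact: exchange_sorted_minimals.
Qed.
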